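(* For every $n\ge 1$, the total number of east steps that lie below the subdiagonal $y=x-1$, summed over all paths $L\in\mathcal{L}_n$, equals the sum of the areas under all Dyck paths in $\mathcal{D}_n$.
   Context: $\mathcal{L}_n$ is the set of lattice paths from $(0,0)$ to $(n,n)$ consisting of unit north steps $(0,1)$ and unit east steps $(1,0)$. An east step from $(a,b)$ to $(a+1,b)$ is below the subdiagonal $y=x-1$ if $b\le a-1$ (i.e. its endpoint lies strictly below the line $y=x-1$). $\mathcal{D}_n\subseteq\mathcal{L}_n$ is the set of Dyck paths, i.e. paths in $\mathcal{L}_n$ which stay weakly below the diagonal $y=x$. The area under a Dyck path is the area of the region between the path, the $x$-axis and the vertical line $x=n$, i.e. the sum over its east steps of their heights ($y$-coordinates); for instance for $n=3$ the five Dyck paths have areas $0,1,2,2,3$. *)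

(* Defs.v *)
From mathcomp Require Import all_boot.

Set Implicit Arguments.
Unset Strict Implicit.
Unset Printing Implicit Defensive.

Definition step := bool.
Definition north : step := false.
Definition east : step := true.

(* The lattice point reached from (0,0) after the first k steps of p. *)
Definition point (p : seq step) (k : nat) : nat * nat :=
  (count_mem east (take k p), count_mem north (take k p)).

(* A path from (0,0) to (n,n) necessarily has 2n steps. *)
Definition lattice_paths (n : nat) : {set (n + n).-tuple step} :=
  [set p : (n + n).-tuple step | point p (size p) == (n, n)].

Definition weakly_below_diagonal (u : nat * nat) : bool := u.2 <= u.1.

Definition dyck_paths (n : nat) : {set (n + n).-tuple step} :=
  [set p in lattice_paths n |
    [forall k : 'I_(n + n).+1, weakly_below_diagonal (point p k)]].

(* For an east step starting at u = (a, b): the condition b <= a - 1 over the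
   integers, written without the truncated subtraction of nat (which would
   wrongly accept a = b = 0). *)
Definition below_subdiagonal (u : nat * nat) : bool := u.2 + 1 <= u.1.

Definition east_steps_below (m : nat) (p : m.-tuple step) : nat :=
  #|[set k : 'I_m | (tnth p k == east) && below_subdiagonal (point p k)]|.

(* The k-th step, when east, is at height (point p k).2. *)
Definition area (m : nat) (p : m.-tuple step) : nat :=
  \sum_(k < m | tnth p k == east) (point p k).2.

(* Main.v *)
Require Import Defs.
From mathcomp Require Import all_boot.
From mathcomp Require Import zify.

(** Both totals refine to families indexed by the endpoint [(e, n)], and deleting
    the last step of a path gives a Pascal-type recursion for each.  The
    solutions have closed forms: writing [N = 'C(e + n, e)], [d = e - n],
    [t = \sum_(i < e) 'C(e + n, i)] and [u = \sum_(i < n) 'C(e + n, i)],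
    twice the number of east steps below the subdiagonal is [e N + (d - 2) t]
    for [d <= 2], and twice the area under the paths that stay weakly below the
    diagonal is [(d + 1) (n N - 2 u)] for [d >= -1].  At [d = 0] we have [t = u]
    and the two expressions coincide. *)

(** * Appending one step to a path *)

Lemma point_rcons (p : seq step) b k :
  k <= size p -> point (rcons p b) k = point p k.
Proof. by move=> kp; rewrite /point -cats1 takel_cat. Qed.

Lemma point_rcons_size (p : seq step) b :
  point (rcons p b) (size p).+1 =
  ((point p (size p)).1 + (b == east), (point p (size p)).2 + (b == north)).
Proof.
rewrite /point !take_size take_oversize ?size_rcons //.
by rewrite -cats1 !count_cat /= !addn0.
Qed.

(** With an arbitrary region [B], one recursion serves both families: [predT] gives all paths,
    [weakly_below_diagonal] the Dyck paths. *)
Definition confined (B : pred (nat * nat)) (p : seq step) : bool :=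
  all (fun k => B (point p k)) (iota 0 (size p).+1).

Lemma confined_rcons B p b :
  confined B (rcons p b) =
  confined B p && B (point (rcons p b) (size p).+1).
Proof.
rewrite /confined size_rcons -(addn1 (size p).+1) iotaD all_cat.
congr (_ && _); last by rewrite /= andbT.
apply: eq_in_all => k; rewrite mem_iota add0n ltnS => /andP[_ kp].
by rewrite point_rcons.
Qed.

Definition east_sum (g : nat * nat -> nat) (p : seq step) : nat :=
  \sum_(k < size p | nth north p k == east) g (point p k).

Lemma east_sum_rcons g p b :
  east_sum g (rcons p b) =
  east_sum g p + (b == east) * g (point p (size p)).
Proof.
rewrite /east_sum size_rcons big_mkcond big_ord_recr /= nth_rcons ltnn eqxx.
rewrite point_rcons //; congr (_ + _); last first.
  by case: (b == east); rewrite ?mul1n.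
rewrite [RHS]big_mkcond /=; apply: eq_bigr => k _.
by rewrite nth_rcons ltn_ord point_rcons // ltnW.
Qed.

(** * Path sums by endpoint and their recursion *)

Lemma sum_rcons_tuple m (P : pred (seq step)) (f : seq step -> nat) :
  \sum_(p : m.+1.-tuple step | P p) f p =
  \sum_(p : m.-tuple step | P (rcons p east)) f (rcons p east) +
  \sum_(p : m.-tuple step | P (rcons p north)) f (rcons p north).
Proof.
pose h (bq : bool * m.-tuple step) : m.+1.-tuple step :=
  [tuple of rcons bq.2 bq.1].
have h_inj : injective h.
  move=> [b q] [b' q'] /(congr1 val) /= /rcons_inj[eq_q ->].
  by rewrite (val_inj eq_q).
have h_bij : bijective h.
  apply: (inj_card_bij h_inj).
  by rewrite card_prod !card_tuple card_bool expnS leqnn.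
rewrite (reindex h) /=; last exact: onW_bij.
rewrite -(pair_big_dep xpredT (fun b (q : m.-tuple step) => P (rcons q b))
  (fun b q => f (rcons q b))) /=.
by rewrite big_bool.
Qed.

(** The length [m] is kept as the induction variable; the sum is empty unless [m] is the sum of the
    coordinates of [u]. *)
Definition path_sum B (f : seq step -> nat) m u : nat :=
  \sum_(p : m.-tuple step | confined B p && (point p (size p) == u)) f p.

Lemma path_sum0 B f u :
  path_sum B f 0 u = if B (0, 0) && (u == (0, 0)) then f [::] else 0.
Proof.
rewrite /path_sum big_mkcond (big_pred1 [tuple]) /=; last first.
  by move=> p; rewrite [p]tuple0 /= eqxx.
by rewrite /confined /= andbT /point /= eq_sym.
Qed.

Lemma path_sumS B f m e n :
  path_sum B f m.+1 (e, n) =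
  if B (e, n) then
    (if e is e'.+1 then
       path_sum B (fun p => f (rcons p east)) m (e', n) else 0) +
    (if n is n'.+1 then
       path_sum B (fun p => f (rcons p north)) m (e, n') else 0)
  else 0.
Proof.
rewrite /path_sum
  (sum_rcons_tuple _ (fun p => confined B p && (point p (size p) == (e, n)))).
(* The only new constraint is at the last point, which the endpoint test fixes at [(e, n)], so
   [B (e, n)] leaves the sum. *)
have lastE b (p : seq step) :
    confined B (rcons p b) &&
      (point (rcons p b) (size (rcons p b)) == (e, n)) =
    [&& B (e, n), confined B p &
      point (rcons p b) (size p).+1 == (e, n)].
  rewrite confined_rcons size_rcons -andbA [RHS]andbCA; congr (_ && _).
  by case: eqP => [->|]; rewrite ?andbF.
under eq_bigl => p do rewrite lastE point_rcons_size xpair_eqE /= addn1 addn0.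
under [X in _ + X]eq_bigl => p
  do rewrite lastE point_rcons_size xpair_eqE /= addn1 addn0.
case: (B (e, n)); last by rewrite !big_pred0.
congr (_ + _).
- case: e {lastE} => [|e]; first by rewrite big_pred0 // => p; rewrite andbF.
  by apply: eq_bigl => p; rewrite -xpair_eqE.
- case: n {lastE} => [|n]; first by rewrite big_pred0 // => p; rewrite !andbF.
  by apply: eq_bigl => p; rewrite eqSS -xpair_eqE.
Qed.

Definition path_count B m u := path_sum B (fun=> 1) m u.

Definition east_total B g m u := path_sum B (east_sum g) m u.

Lemma path_countS B m e n :
  path_count B m.+1 (e, n) =
  if B (e, n) then
    (if e is e'.+1 then path_count B m (e', n) else 0) +
    (if n is n'.+1 then path_count B m (e, n') else 0)
  else 0.
Proof. exact: path_sumS. Qed.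

(** A last east step starts at [(e', n)], hence adds [g (e', n)] once per path ending there; a last
    north step adds nothing. *)
Lemma east_totalS B g m e n :
  east_total B g m.+1 (e, n) =
  if B (e, n) then
    (if e is e'.+1 then
       east_total B g m (e', n) + g (e', n) * path_count B m (e', n) else 0) +
    (if n is n'.+1 then east_total B g m (e, n') else 0)
  else 0.
Proof.
rewrite /east_total path_sumS; case: (B _) => //; congr (_ + _).
- case: e => // e; rewrite /path_count /path_sum big_distrr -big_split /=.
  by apply: eq_bigr => p /andP[_ /eqP pu]; rewrite east_sum_rcons pu mul1n muln1.
- case: n => // n; apply: eq_bigr => p _.
  by rewrite east_sum_rcons addn0.
Qed.

(** * Partial sums of binomial coefficients *)

Definition binom_tail m k := \sum_(i < k) 'C(m, i).

Lemma binom_tail0 m : binom_tail m 0 = 0.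
Proof. exact: big_ord0. Qed.

Lemma binom_tail_recr m k : binom_tail m k.+1 = binom_tail m k + 'C(m, k).
Proof. exact: big_ord_recr. Qed.

Lemma binom_tailS m k :
  binom_tail m.+1 k.+1 = binom_tail m k.+1 + binom_tail m k.
Proof.
elim: k => [|k IH]; first by rewrite !binom_tail_recr !binom_tail0 !bin0.
by rewrite binom_tail_recr IH binS !binom_tail_recr; lia.
Qed.

Lemma bin_cross e n :
  n.+1 * 'C(e + n.+1, e) = e.+1 * 'C(e + n.+1, e.+1).
Proof. by rewrite mul_bin_left addKn. Qed.

(** * Closed forms *)

Lemma path_count_free m e n :
  m = e + n -> path_count predT m (e, n) = 'C(m, e).
Proof.
elim: m e n => [|m IH] e n mE.
  by case: e n mE => [|?] [|?] //; rewrite /path_count path_sum0.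
rewrite path_countS /=; case: e n mE => [|e] [|n] mE; first by lia.
- by rewrite add0n IH ?bin0 //; lia.
- rewrite addn0 IH; last by lia.
  have -> : m = e by lia.
  by rewrite !binn.
- by rewrite !IH ?binS 1?addnC //; lia.
Qed.

(** Ballot numbers: ['C(m, e.+1)] counts the paths that reflection in y = x + 1 would discard. The
    induction uses Pascal's rule instead, with the line n = e + 1 as boundary: there the count is 0
    and the binomials agree by symmetry. *)
Lemma path_count_dyck m e n : m = e + n -> n <= e.+1 ->
  path_count weakly_below_diagonal m (e, n) + 'C(m, e.+1) = 'C(m, e).
Proof.
elim: m e n => [|m IH] e n mE ne.
  by case: e n mE ne => [|?] [|?] //; rewrite /path_count path_sum0.
rewrite path_countS /weakly_below_diagonal /= -/weakly_below_diagonal.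
case: leqP => [{}ne|en].
  case: e n mE ne => [|e] [|n] mE ne; try by lia.
  - have IHe := IH e 0 ltac:(lia) isT.
    have C1 : 'C(m, e.+1) = 0 by rewrite bin_small //; lia.
    have C2 : 'C(m, e.+2) = 0 by rewrite bin_small //; lia.
    by rewrite !binS; lia.
  - have := IH e n.+1 ltac:(lia) ltac:(lia).
    have := IH e.+1 n ltac:(lia) ltac:(lia).
    by rewrite !binS; lia.
by rewrite add0n -(@bin_sub _ e); [congr 'C(_, _); lia | lia].
Qed.

(** The factor [e.+1 - n] is d + 1; it vanishes on the forbidden line n = e + 1, which supplies the
    boundary value. *)
Lemma east_total_dyck m e n : m = e + n -> n <= e.+1 ->
  2 * east_total weakly_below_diagonal snd m (e, n) +
    2 * (e.+1 - n) * binom_tail m n = (e.+1 - n) * n * 'C(m, e).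
Proof.
elim: m e n => [|m IH] e n mE ne.
  case: e n mE ne => [|?] [|?] //; rewrite /east_total path_sum0 /=.
  by rewrite /east_sum big_ord0 binom_tail0.
rewrite east_totalS /weakly_below_diagonal /= -/weakly_below_diagonal.
case: leqP => [{}ne|en]; last by have -> : e.+1 - n = 0; lia.
case: e n mE ne => [|e] [|n] mE ne; try by lia.
- have := IH e 0 ltac:(lia) isT.
  by rewrite !binom_tail0; lia.
- have IHe := IH e n.+1 ltac:(lia) ltac:(lia).
  have IHn := IH e.+1 n ltac:(lia) ltac:(lia).
  have D := path_count_dyck m e n.+1 ltac:(lia) ltac:(lia).
  (* After the induction hypotheses and [D] are substituted, the tails cancel and exactly this
     relation remains. *)
  have X : n.+1 * 'C(m, e) = e.+1 * 'C(m, e.+1).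
    by rewrite (_ : m = e + n.+1); [exact: bin_cross | lia].
  have Csym : 'C(m, n) = 'C(m, e.+1).
    by rewrite -(@bin_sub _ n); [congr 'C(_, _); lia | lia].
  move: IHe IHn; rewrite binom_tailS binS binom_tail_recr Csym.
  (* Writing e = n + j turns the truncated differences into j, j + 1 and j + 2, leaving a polynomial
     identity. *)
  have [j eE] : exists j, e = n + j by exists (e - n); lia.
  have -> : e.+1 - n.+1 = j by lia.
  have -> : e.+2 - n = j.+2 by lia.
  have -> : e.+2 - n.+1 = j.+1 by lia.
  move: D X; move: (path_count _ _ _) (east_total _ _ _ _) (east_total _ _ _ _).
  move: (binom_tail _ _) 'C(m, e.+1) 'C(m, e) => S c c' d a a'.
  clear -eE; rewrite {}eE; nia.
Qed.

(* The source term of the recursion starts at [d = 2], so each side has its own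
   closed form.  They agree at [d = 1], where [t = N + u], and at [d = 2], where
   [d - 2] kills the tails; the recursion needs both overlaps. *)
Lemma east_total_below_subdiagonal m e n : m = e + n ->
  (e <= n.+2 ->
   2 * east_total predT below_subdiagonal m (e, n) + n.+2 * binom_tail m e =
   e * 'C(m, e) + e * binom_tail m e) /\
  (n < e ->
   2 * east_total predT below_subdiagonal m (e, n) +
     n.+2 * ('C(m, e) + binom_tail m n) =
   2 * e * 'C(m, e) + e * binom_tail m n).
Proof.
elim: m e n => [|m IH] e n mE.
  case: e n mE => [|?] [|?] // _; rewrite /east_total path_sum0 /=.
  by rewrite /east_sum big_ord0 binom_tail0.
(* It suffices to treat d <= 1 by the first form and d >= 2 by the second; the overlaps d = 2 and d
   = 1 follow by conversion. *)
suff [le1 ge2] :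
    (e <= n.+1 ->
     2 * east_total predT below_subdiagonal m.+1 (e, n) +
       n.+2 * binom_tail m.+1 e =
     e * 'C(m.+1, e) + e * binom_tail m.+1 e) /\
    (n.+1 < e ->
     2 * east_total predT below_subdiagonal m.+1 (e, n) +
       n.+2 * ('C(m.+1, e) + binom_tail m.+1 n) =
     2 * e * 'C(m.+1, e) + e * binom_tail m.+1 n).
  split=> en; case: (ltnP n.+1 e) => ne; [|exact: le1|exact: ge2|].
    have {en} eE : e = n.+2 by lia.
    by move: (ge2 ne); rewrite eE; lia.
  have eE : e = n.+1 by lia.
  have Csym : 'C(m.+1, n) = 'C(m.+1, e).
    by rewrite -(@bin_sub _ n); [congr 'C(_, _); lia | lia].
  by move: (le1 ne); rewrite [in binom_tail _ e]eE binom_tail_recr Csym eE; lia.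
rewrite east_totalS /=.
case: e n mE => [|e] [|n] mE; first by lia.
- have [le _] := IH 0 n ltac:(lia); split => // _.
  by move: (le isT); rewrite !binom_tail0; lia.
- have [le ge] := IH e 0 ltac:(lia).
  have em : m = e by lia.
  have Z : below_subdiagonal (e, 0) = (0 < e) by rewrite /below_subdiagonal addn1.
  move: le ge; rewrite path_count_free ?Z; last by lia.
  rewrite em binom_tail_recr !binom_tail0 !binn.
  case: e {em mE IH Z} => [|e] le ge; split=> // _.
    by move: (le isT); rewrite !binom_tail0 bin0; lia.
  by move: (ge isT); lia.
have mEe : m = e + n.+1 by lia.
have mEn : m = e.+1 + n by lia.
have [IHe1 IHe2] := IH e n.+1 mEe; have [IHn1 IHn2] := IH e.+1 n mEn.
have Z : below_subdiagonal (e, n.+1) = (n.+1 < e).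
  by rewrite /below_subdiagonal addn1.
rewrite (path_count_free _ _ _ mEe) Z !binom_tailS !binS.
have Csym : 'C(m, n) = 'C(m, e.+1).
  by rewrite -(@bin_sub _ n); [congr 'C(_, _); lia | lia].
(* The predecessors have differences d - 1 and d + 1: at d = 1 the first form is called at 2, at d =
   2 the second is called at 1. *)
split=> en.
- have -> : n.+1 < e = false by lia.
  move: (IHe1 ltac:(lia)) (IHn1 ltac:(lia)).
  by rewrite !binom_tail_recr; lia.
- have en' : n.+1 < e by lia.
  rewrite en'; move: (IHe2 en') (IHn2 ltac:(lia)).
  by rewrite !binom_tail_recr Csym; lia.
Qed.

(** * Back to the original totals *)

Lemma east_steps_belowE m (p : m.-tuple step) :
  east_steps_below p = east_sum below_subdiagonal p.
Proof.
rewrite /east_steps_below cardsE -sum1_card /east_sum size_tuple big_mkcondr /=.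
by apply: eq_big => [k|k _]; [rewrite (tnth_nth north) | case: below_subdiagonal].
Qed.

Lemma areaE m (p : m.-tuple step) : area p = east_sum snd p.
Proof.
rewrite /area /east_sum size_tuple.
by apply: eq_bigl => k; rewrite (tnth_nth north).
Qed.

Lemma lattice_paths_total n :
  \sum_(L in lattice_paths n) east_steps_below L =
  east_total predT below_subdiagonal (n + n) (n, n).
Proof.
apply: eq_big => [p|p _]; last exact: east_steps_belowE.
by rewrite inE /confined all_predT.
Qed.

Lemma dyck_paths_total n :
  \sum_(D in dyck_paths n) area D =
  east_total weakly_below_diagonal snd (n + n) (n, n).
Proof.
apply: eq_big => [p|p _]; last exact: areaE.
rewrite !inE andbC; congr (_ && _).
rewrite /confined size_tuple; apply/forallP/allP => [ok k|ok k].
  by rewrite mem_iota add0n => kn; exact: (ok (Ordinal kn)).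
by apply: ok; rewrite mem_iota add0n ltn_ord.
Qed.

Theorem mainTheorem7 (n : nat) (hn : 1 <= n) :
  \sum_(L in lattice_paths n) east_steps_below L
    = \sum_(D in dyck_paths n) area D.
Proof.
rewrite lattice_paths_total dyck_paths_total.
have [/(_ ltac:(lia)) free _] :=
  east_total_below_subdiagonal (n + n) n n (erefl _).
have dyck := east_total_dyck (n + n) n n (erefl _) (leqnSn n).
(* Each doubled total plus [2 * binom_tail (n + n) n] equals [n * 'C(n + n, n)]. *)
by move: free dyck; rewrite subSnn; lia.
Qed.
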